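(* Let $\mathcal H$ be a cluster of graphs and let $g\ge 0$ be an integer such that $\mathrm{gen}(\bigcup\mathcal H)>g$. Then there is a subcollection $\mathcal H_g\subseteq\mathcal H$ with $|\mathcal H_g|\le 4g+5$ such that $\mathrm{gen}(\bigcup\mathcal H_g)>g$.
   Context: All surfaces are compact and orientable; $\Sigma_g$ denotes the one of genus $g$. A cluster of graphs is a finite collection $\mathcal H$ of pairwise edge-disjoint connected graphs simultaneously embedded in one surface (so that their union $\bigcup\mathcal H$ is an embedded graph), such that some $H\in\mathcal H$ (an anchor) intersects (shares at least one vertex with) every graph in $\mathcal H$. For a subfamily $\mathcal F$, $\bigcup\mathcal F$ is the embedded graph that is the union of its members. The rotation at a vertex of an embedded graph is the clockwise cyclic order of its incident edges; two embedded graphs are isomorphic if there is an isomorphism of the underlying abstract graphs mapping the rotation at each vertex to the rotation at its image. The genus $\mathrm{gen}(G)$ of an embedded graph $G$ is the least $g$ such that $G$ is isomorphic (as an embedded graph) to a graph embedded in $\Sigma_g$; for connected $G$ with vertex set $V$, edge set $E$ and set of facial walks $\mathcal W$ (determined by the rotations), $\mathrm{gen}(G)=\tfrac12(2-|V|+|E|-|\mathcal W|)$. *)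

(* Defs.v *)
From mathcomp Require Import all_boot.
From mathcomp Require Import boolp classical_sets.

Set Implicit Arguments.
Unset Strict Implicit.
Unset Printing Implicit Defensive.

(* Finite embedded graphs, given by their rotations (Heffter-Edmonds).  Each
   edge is a pair {d, opp d} of oppositely oriented darts, and d starts at
   src d; loops and parallel edges are allowed.  [rot d] is the clockwise
   successor of d around src d, and [rotP] says that the darts leaving a vertex
   form a single cycle of rot, which is the rotation at that vertex.  A vertex
   that is the source of no dart is isolated. *)
Record egraph := EGraph {
  vert : finType;
  dart : finType;
  src : dart -> vert;
  opp : dart -> dart;
  rot : dart -> dart;
  oppK : involutive opp;
  opp_neq : forall d, opp d != d;
  rot_inj : injective rot;
  rotP : forall d e, fconnect rot d e = (src d == src e) }.

Arguments src {G} : rename.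
Arguments opp {G} : rename.
Arguments rot {G} : rename.

Definition adj (G : egraph) : rel (vert G) :=
  [rel u v | [exists d : dart G, (src d == u) && (src (opp d) == v)]].

Definition connected_egraph (G : egraph) : Prop :=
  0 < #|vert G| /\ forall u v : vert G, connect (@adj G) u v.

Definition egraph_iso (G K : egraph) : Prop :=
  exists (fv : vert G -> vert K) (fd : dart G -> dart K),
    [/\ bijective fv, bijective fd,
        forall d, src (fd d) = fv (src d),
        forall d, opp (fd d) = fd (opp d) &
        forall d, rot (fd d) = fd (rot d)].

Definition nedges (G : egraph) : nat := fcard (@opp G) (dart G).

(* A facial walk traverses d, arrives with opp d, and leaves along the next dart
   in the rotation.  An isolated vertex has one facial walk, of length 0, which
   is not an orbit of darts. *)
Definition face (G : egraph) (d : dart G) : dart G := rot (opp d).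

Definition nfacial (G : egraph) : nat :=
  fcard (@face G) (dart G) + #|[set v : vert G | [forall d, src d != v]]|.

(* G is a cellularly embedded graph of the closed orientable surface of genus k:
   k = (2 - |V| + |E| - |W|) / 2, written without subtraction. *)
Definition cellular_in (k : nat) (G : egraph) : Prop :=
  connected_egraph G /\ #|vert G| + nfacial G + k.*2 = nedges G + 2.

Definition subgraphb (G : egraph) (S : {set vert G} * {set dart G}) : bool :=
  [forall d in S.2, (src d \in S.1) && (opp d \in S.2)].

Definition subgraph (G : egraph) := {S : {set vert G} * {set dart G} | subgraphb S}.

Definition sverts (G : egraph) (S : subgraph G) : {set vert G} := (val S).1.
Definition sdarts (G : egraph) (S : subgraph G) : {set dart G} := (val S).2.

Lemma sdarts_src (G : egraph) (S : subgraph G) d :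
  d \in sdarts S -> src d \in sverts S.
Proof. by move=> dS; have /forall_inP/(_ d dS)/andP[] := valP S. Qed.

Lemma sdarts_opp (G : egraph) (S : subgraph G) d :
  d \in sdarts S -> opp d \in sdarts S.
Proof. by move=> dS; have /forall_inP/(_ d dS)/andP[] := valP S. Qed.

(* The cyclic order induced by f on its orbits intersected with B: from d, the
   first of f d, f (f d), ... that lies in B. *)
Section FirstReturn.
Variables (T : finType) (f : T -> T) (B : {set T}).

Definition wait (d : T) : nat :=
  find (fun k => iter k.+1 f d \in B) (iota 0 (order f d)).

Definition first_return (d : T) : T := iter (wait d).+1 f d.

Hypothesis f_inj : injective f.

Lemma wait_lt d : d \in B -> wait d < order f d.
Proof.
move=> dB; rewrite -[X in _ < X](size_iota 0 (order f d)) -has_find; apply/hasP.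
exists (order f d).-1; first by rewrite mem_iota /= add0n prednK ?order_gt0.
by rewrite prednK ?order_gt0 // iter_order.
Qed.

Lemma first_return_in d : d \in B -> first_return d \in B.
Proof.
move=> dB; have lt := wait_lt dB.
have := lt; rewrite -[X in _ < X](size_iota 0 (order f d)) -has_find => /(nth_find 0).
by rewrite -/(wait d) nth_iota.
Qed.

Lemma wait_min d k : d \in B -> iter k.+1 f d \in B -> wait d <= k.
Proof.
move=> dB kB; rewrite leqNgt; apply/negP => lt.
have := before_find 0 lt.
by rewrite nth_iota ?(ltn_trans lt) ?wait_lt // add0n kB.
Qed.

Lemma first_return_inj : {in B &, injective first_return}.
Proof.
move=> d e; wlog le : d e / wait d <= wait e => [W | dB eB].
  case/orP: (leq_total (wait d) (wait e)) => le dB eB E; first exact: W.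
  exact/esym/W.
rewrite /first_return -(subnKC le) -addSn iterD.
set m := wait e - wait d => E.
have {}E : d = iter m f e.
  by elim: (wait d).+1 E => //= n IH /f_inj.
case Dm: m E => [|m'] // E.
have le' : wait e <= m' by apply: wait_min => //; rewrite -E.
by have := leq_subr (wait d) (wait e); rewrite -/m Dm ltnNge le'.
Qed.

End FirstReturn.

Section Induced.
Variables (G : egraph) (S : subgraph G).

Let V := {v : vert G | v \in sverts S}.
Let D := {d : dart G | d \in sdarts S}.

Definition isrc (d : D) : V := Sub (src (val d)) (sdarts_src (valP d)).

Definition iopp (d : D) : D := Sub (opp (val d)) (sdarts_opp (valP d)).

Definition irot (d : D) : D :=
  Sub (first_return rot (sdarts S) (val d)) (first_return_in (@rot_inj G) (valP d)).

Lemma ioppK : involutive iopp.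
Proof. by move=> d; apply: val_inj; rewrite /= oppK. Qed.

Lemma iopp_neq d : iopp d != d.
Proof. by rewrite -val_eqE /= opp_neq. Qed.

Lemma irot_inj : injective irot.
Proof.
move=> d e /(congr1 val) /= E; apply: val_inj.
exact: first_return_inj (@rot_inj G) _ _ (valP d) (valP e) E.
Qed.

Lemma irotP d e : fconnect irot d e = (isrc d == isrc e).
Proof.
rewrite -val_eqE /= -rotP; apply/idP/idP => [/iter_findex <- | ].
  elim: (findex _ _ _) => //= n IH; apply: connect_trans IH _.
  exact: fconnect_iter.
move/iter_findex; move: (findex _ _ _) => n.
elim/ltn_ind: n d => -[|n] IH d E.
  by rewrite (val_inj E : d = e) connect0.
have le : wait rot (sdarts S) (val d) <= n.
  by apply: wait_min (@rot_inj G) _ _ (valP d) _; rewrite E (valP e).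
apply: connect_trans (fconnect1 irot d) _.
apply: (IH (n - wait rot (sdarts S) (val d))); first by rewrite ltnS leq_subr.
by rewrite /= /first_return -iterD addnS subnK.
Qed.

(* A subgraph, with the rotations inherited from G. *)
Definition induced : egraph := EGraph ioppK iopp_neq irot_inj irotP.

End Induced.

(* G is isomorphic to a graph embedded in the closed orientable surface of genus
   k: the (not necessarily connected or cellular) graphs embedded there are the
   subgraphs of its cellularly embedded graphs. *)
Definition embeds_in (k : nat) (G : egraph) : Prop :=
  exists (M : egraph) (S : subgraph M), cellular_in k M /\ egraph_iso G (induced S).

(* The least k with embeds_in k G.  The default value 0 is irrelevant: every
   embedded graph has such a k. *)
Definition gen (G : egraph) : nat :=
  xget 0 (fun k => embeds_in k G /\ forall j, embeds_in j G -> k <= j).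

Lemma subgraphb_union (G : egraph) (F : {set subgraph G}) :
  subgraphb (\bigcup_(H in F) sverts H, \bigcup_(H in F) sdarts H).
Proof.
apply/forall_inP => d /= /bigcupP[H HF dH].
by apply/andP; split; apply/bigcupP; exists H;
   rewrite ?sdarts_src ?sdarts_opp.
Qed.

Definition union (G : egraph) (F : {set subgraph G}) : subgraph G :=
  Sub (\bigcup_(H in F) sverts H, \bigcup_(H in F) sdarts H) (subgraphb_union F).

(* The surface in which all members are simultaneously embedded enters only
   through the rotations of the ambient embedded graph G. *)
Definition cluster (G : egraph) (F : {set subgraph G}) : Prop :=
  [/\ forall H, H \in F -> connected_egraph (induced H),
      forall H K, H \in F -> K \in F -> H != K -> [disjoint sdarts H & sdarts K] &
      exists2 A, A \in F &
        forall H, H \in F -> ~~ [disjoint sverts A & sverts H]].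

(* Main.v *)
Require Import Defs.
From mathcomp Require Import all_boot.
From mathcomp Require Import zify ring lra.
From mathcomp Require Import boolp.
From mathcomp Require classical_sets.
From mathcomp Require Import all_order all_algebra.
(* [seq] also exports a [rot]. *)
Import Defs.

(** Twice the genus of a connected embedded graph is the rank of the intersection
form on its space of cycles (1-chains without boundary, over the rationals), and
the intersection numbers of cycles of a subgraph can be computed in the subgraph
or in the whole graph.  For the rank: a cycle is the jump of a potential on the
corners; these potentials have dimension |E| + 1, and the radical of the form on
them is spanned by the functions constant around each vertex and those constant
along each face, so has dimension |V| + |W| - 1.  Hence a connected graph has
genus > g if and only if it carries 2g + 2 cycles with a nonsingular matrix of
intersection numbers.

The members of a cluster with anchor A being connected, every cycle of the union
is a sum of cycles, each in some A u H u H'.  As the form is skew, the given 2g + 2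
cycles can be exchanged one by one for such generators without making the matrix
singular.  The 2g + 2 resulting cycles live in A and at most 2(2g + 2) further
members, which makes 4g + 5. *)

Set Implicit Arguments.
Unset Strict Implicit.
Unset Printing Implicit Defensive.

Import Order.TTheory GRing.Theory Num.Theory.

Local Open Scope ring_scope.

(** * Principal minors of skew-symmetric matrices *)

Section SkewMatrices.
Variable K : numFieldType.

Lemma unitmx_inj n (A : 'M[K]_n) :
  (forall v : 'rV_n, v *m A = 0 -> v = 0) -> A \in unitmx.
Proof. by move=> inj; rewrite -row_free_unit; apply: inj_row_free. Qed.

Lemma skew_diag n (A : 'M[K]_n) i : A^T = - A -> A i i = 0.
Proof.
move=> /matrixP/(_ i i); rewrite !mxE => /eqP.
by rewrite -addr_eq0 -mulr2n mulrn_eq0 => /eqP.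
Qed.

Lemma skew_invmx n (A : 'M[K]_n) :
  A^T = - A -> A \in unitmx -> (invmx A)^T = - invmx A.
Proof.
move=> skA uA; rewrite trmx_inv skA; have uN : - A \in unitmx.
  by rewrite -row_free_unit /row_free mxrank_opp -/(row_free A) row_free_unit.
by apply: (can_inj (mulKmx uN)); rewrite mulmxV // mulmxN mulNmx opprK mulmxV.
Qed.

(* If [invmx A i j != 0], the indices i and j can be removed: the minor of A on
   the other indices is det A times the square of that entry. *)
Lemma skew_drop2 n (A : 'M[K]_n.+2) :
  A^T = - A -> A \in unitmx ->
  exists f : 'I_n -> 'I_n.+2, mxsub f f A \in unitmx.
Proof.
move=> skA uA; set N := invmx A.
have skN : N^T = - N by exact: skew_invmx.
have [i [j Nij]] : exists i j, N i j != 0.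
  have [/existsP[i /existsP[j Nij]]|] := boolP [exists i, exists j, N i j != 0].
    by exists i, j.
  rewrite negb_exists => /forallP nN.
  have N0 : N = 0.
    apply/matrixP => i j; rewrite mxE; apply/eqP; apply: contraT => Nij.
    by have /existsP[] := nN i; exists j.
  move/matrixP/(_ ord0 ord0): (mulmxV uA); rewrite -/N N0 mulmx0 !mxE eqxx.
  by move/esym/eqP; rewrite oner_eq0.
have NE k l : N l k = - N k l by move/matrixP/(_ k l): skN; rewrite !mxE.
have ij : i != j by apply: contraNneq Nij => <-; rewrite (skew_diag i skN).
have [j' jE _] := unlift_some ij.
pose f k := lift i (lift j' k).
have fi k : f k != i by rewrite eq_sym; apply: neq_lift.
have fj k : f k != j by rewrite jE (inj_eq lift_inj) eq_sym neq_lift.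
have f_inj : injective f by move=> k l /lift_inj/lift_inj.
have fP l : l != i -> l != j -> exists k, l = f k.
  rewrite eq_sym => li lj; have [l' E _] := unlift_some li.
  have jl' : j' != l' by apply: contraNneq lj => E'; rewrite E jE E'.
  by have [k E' _] := unlift_some jl'; exists k; rewrite E E'.
exists f; apply: unitmx_inj => v v0.
(* [w] extends [v] by zero at i and j, so [w *m A] is supported on {i, j} and [w] is a combination
   of rows i and j of [N]. As [w] vanishes at i and j while [N i j != 0], both coefficients are
   zero. *)
pose w : 'rV_n.+2 := v *m rowsub f 1%:M.
have wf k : w 0 (f k) = v 0 k.
  rewrite mxE (bigD1 k) //= !mxE eqxx mulr1 big1 ?addr0 // => l lk.
  by rewrite !mxE (inj_eq f_inj) (negbTE lk) mulr0.
have w0 l : (forall k, f k != l) -> w 0 l = 0.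
  by move=> fl; rewrite mxE big1 // => k _; rewrite !mxE (negbTE (fl k)) mulr0.
have wA k : (w *m A) 0 (f k) = 0.
  move/matrixP/(_ 0 k): v0; rewrite [in X in _ = X -> _]mxE => <-.
  by rewrite -mulmxA mul_rowsub_mx mul1mx !mxE; apply: eq_bigr => l _; rewrite !mxE.
have wN l : w 0 l = (w *m A) 0 i * N i l + (w *m A) 0 j * N j l.
  rewrite -[in LHS](mulmxK uA w) mxE (bigD1 i) //= (bigD1 j) ?(eq_sym j) //=.
  rewrite big1 ?addr0 // => m /andP[mi mj]; have [k ->] := fP m mi mj.
  by rewrite wA mul0r.
have bi : (w *m A) 0 j = 0.
  have /esym/eqP := wN i; rewrite w0 // (skew_diag i skN) mulr0 add0r.
  by rewrite NE mulrN oppr_eq0 mulf_eq0 (negbTE Nij) orbF => /eqP.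
have bj : (w *m A) 0 i = 0.
  have /esym/eqP := wN j; rewrite w0 // (skew_diag j skN) mulr0 addr0.
  by rewrite mulf_eq0 (negbTE Nij) orbF => /eqP.
by apply/rowP => k; rewrite mxE -wf wN bi bj !mul0r addr0.
Qed.

(** Removing two indices at a time by [skew_drop2] would end, for odd n, at an invertible 1 x 1 skew
    matrix, which is zero. *)
Lemma skew_unit_even n (A : 'M[K]_n) : A^T = - A -> A \in unitmx -> ~~ odd n.
Proof.
elim/ltn_ind: n A => -[|[|n]] IH A skA uA //.
  have A0 : A = 0.
    by apply/matrixP => i j; rewrite !ord1 [in RHS]mxE (skew_diag _ skA).
  by move: uA; rewrite A0 unitmxE det0 unitr0.
have [f uf] := skew_drop2 skA uA; rewrite /= negbK; apply: IH uf => //.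
by rewrite trmx_mxsub skA; apply/matrixP => i j; rewrite !mxE.
Qed.

(** Skewness makes the columns with the indices of a row basis a column basis. Each row being a
    combination [X] of the chosen rows, these columns factor through the principal minor, which
    therefore has full rank. *)
Lemma skew_max_minor n (A : 'M[K]_n) :
  A^T = - A -> exists f : 'I_(\rank A) -> 'I_n, mxsub f f A \in unitmx.
Proof.
move=> skA; pose f := maxrankfun A; exists f.
have /submxP[X AE] : (A <= rowsub f A)%MS by rewrite eq_maxrowsub.
rewrite -row_free_unit /row_free eqn_leq rank_leq_row /=.
have rkA : \rank A = \rank (colsub f A).
  rewrite -[in LHS](eq_maxrowsub A) -/f -mxrank_tr trmx_mxsub skA.
  rewrite -[LHS]mxrank_opp; congr (\rank _).
  by apply/matrixP => i j; rewrite !mxE opprK.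
apply: leq_trans (_ : \rank (colsub f A) <= _)%N; first by rewrite -rkA.
have -> : colsub f A = X *m mxsub f f A.
  apply/matrixP => i j; rewrite mxE; move/matrixP/(_ i (f j)): AE => ->.
  by rewrite !mxE; apply: eq_bigr => k _; rewrite !mxE.
exact: mxrankM_maxr.
Qed.

End SkewMatrices.

(** * Exchanging vectors in a nonsingular Gram matrix *)

Section Gram.
Variables (K : numFieldType) (U : Type) (b : U -> U -> K).
Hypothesis b_skew : forall u v, b u v = - b v u.

Definition gram n (p : 'I_n -> U) : 'M[K]_n := \matrix_(i, j) b (p i) (p j).

Lemma gram_skew n (p : 'I_n -> U) : (gram p)^T = - gram p.
Proof. by apply/matrixP => i j; rewrite !mxE b_skew. Qed.

Lemma gram_sub m n (f : 'I_m -> 'I_n) (p : 'I_n -> U) :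
  gram (p \o f) = mxsub f f (gram p).
Proof. by apply/matrixP => i j; rewrite !mxE. Qed.

(* The span of the p k with k != i has a one-dimensional radical, spanned by the
   vector w given by row i of the inverse Gram matrix; replacing p i by any s
   not orthogonal to w keeps the Gram matrix invertible. *)
Lemma gram_exchange n (p : 'I_n -> U) i (Q : U -> Prop) :
  gram p \in unitmx ->
  (forall w : 'I_n -> K, \sum_k w k * b (p k) (p i) != 0 ->
     exists2 s, Q s & \sum_k w k * b (p k) s != 0) ->
  exists2 s, Q s & gram (fun k => if k == i then s else p k) \in unitmx.
Proof.
move=> up HQ; set A := gram p in up; pose w := row i (invmx A).
have wA : w *m A = delta_mx 0 i by rewrite -row_mul mulVmx // row1.
have wi : w 0 i = 0.
  by rewrite mxE (skew_diag i (skew_invmx (gram_skew p) up)).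
have wb l : \sum_k w 0 k * b (p k) (p l) = (l == i)%:R.
  move/matrixP/(_ 0 l): wA; rewrite !mxE => <-; apply: eq_bigr => k _.
  by rewrite [A k l]mxE.
have [|s Qs ws] := HQ (fun k => w 0 k); first by rewrite wb eqxx oner_eq0.
exists s => //; set c := \sum_k _ in ws; set p' := fun k => _.
apply: unitmx_inj => v v0.
have p'i : p' i = s by rewrite /p' eqxx.
have p'N k : k != i -> p' k = p k by rewrite /p' => /negbTE ->.
have wp' u : \sum_k w 0 k * b (p' k) u = \sum_k w 0 k * b (p k) u.
  apply: eq_bigr => k _; have [->|/p'N ->] := eqVneq k i => //.
  by rewrite wi !mul0r.
have vp' l : \sum_k v 0 k * b (p' k) (p' l) = 0.
  move/matrixP/(_ 0 l): v0; rewrite !mxE => E; rewrite -[RHS]E.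
  by apply: eq_bigr => k _; rewrite mxE.
have vi : v 0 i = 0.
  (* Pairing the combinations of [p'] with coefficients [w] and [v] gives 0, since [v] is in the
     kernel. By skewness only the term k = i survives, and it equals [v 0 i * c] up to sign. *)
  have : \sum_l w 0 l * (\sum_k v 0 k * b (p' k) (p' l)) = 0.
    by rewrite big1 // => l _; rewrite vp' mulr0.
  under eq_bigr do rewrite mulr_sumr.
  rewrite exchange_big /= (bigD1 i) //= [X in _ + X]big1 => [|k ki].
    rewrite addr0 p'i => /eqP.
    rewrite (eq_bigr (fun l => - v 0 i * (w 0 l * b (p' l) s))) => [|l _].
      rewrite -mulr_sumr wp' -/c mulf_eq0 (negbTE ws) orbF oppr_eq0.
      by move/eqP.
    by rewrite b_skew mulNr !mulrN mulrCA.
  rewrite (eq_bigr (fun l => - v 0 k * (w 0 l * b (p' l) (p' k)))) => [|l _].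
    by rewrite -mulr_sumr wp' p'N // wb (negbTE ki) mulr0.
  by rewrite b_skew mulNr !mulrN mulrCA.
have vp u : \sum_k v 0 k * b (p' k) u = \sum_k v 0 k * b (p k) u.
  apply: eq_bigr => k _; have [->|/p'N ->] := eqVneq k i => //.
  by rewrite vi !mul0r.
(* Now [v] is orthogonal to every [p l] with l != i, so it is a multiple of [w]; pairing with [s]
   shows that the factor [a] is zero. *)
pose a := (v *m A) 0 i.
have vA : v *m A = a *: delta_mx 0 i.
  apply/rowP => l; rewrite !mxE; have [->|li] := eqVneq l i.
    by rewrite mulr1 /a mxE.
  rewrite mulr0 -[RHS](vp' l) vp p'N //; apply: eq_bigr => k _.
  by rewrite [A k l]mxE.
have vw : v = a *: w.
  by rewrite -(mulmxK up v) -/A vA -wA -scalemxAl mulmxK.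
have a0 : a = 0.
  have /eqP := vp' i; rewrite vp p'i vw.
  under eq_bigr do rewrite mxE -mulrA.
  by rewrite -mulr_sumr mulf_eq0 (negbTE ws) orbF => /eqP.
by rewrite vw a0 scale0r.
Qed.

(** After m exchanges the first m vectors satisfy [Q] and the others still satisfy [R]. As the
    family is mixed, the hypothesis allows functionals built from arbitrary [q]. *)
Lemma gram_exchange_all n (p : 'I_n -> U) (R Q : U -> Prop) :
  (forall i, R (p i)) ->
  gram p \in unitmx ->
  (forall u, R u -> forall m (w : 'I_m -> K) (q : 'I_m -> U),
    \sum_k w k * b (q k) u != 0 -> exists2 s, Q s & \sum_k w k * b (q k) s != 0) ->
  exists2 q : 'I_n -> U, forall i, Q (q i) & gram q \in unitmx.
Proof.
move=> Rp up HQ.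
suff IH m : (m <= n)%N -> exists2 q : 'I_n -> U,
    forall i : 'I_n, if (i < m)%N then Q (q i) else R (q i) & gram q \in unitmx.
  have [q Qq uq] := IH n (leqnn n); exists q => // i.
  by have := Qq i; rewrite ltn_ord.
elim: m => [_|m IHm lt]; first by exists p.
have [q Qq uq] := IHm (ltnW lt); pose i := Ordinal lt.
have Ri : R (q i) by have := Qq i; rewrite /= ltnn.
have [s Qs us] := gram_exchange uq (fun w => HQ _ Ri n w q).
exists (fun k => if k == i then s else q k) => // k.
have [->|ki] := eqVneq k i; first by rewrite /= ltnS leqnn.
rewrite ltnS leq_eqVlt; have -> : (k == m :> nat) = false by apply: negbTE.
exact: Qq.
Qed.

End Gram.

(** * Matrices of self-maps of a finite set *)

Section DartMatrices.
Variables (K : realFieldType) (D : finType).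

Definition fnv (p : D -> K) : 'rV[K]_#|D| := \row_j p (enum_val j).

(** The operator of precomposition with [f], acting on row vectors; hence products follow the order
    of composition. *)
Definition fn_mx (f : D -> D) : 'M[K]_#|D| :=
  \matrix_(i, j) (enum_val i == f (enum_val j))%:R.

Lemma fnvK (v : 'rV[K]_#|D|) : fnv (fun d => v 0 (enum_rank d)) = v.
Proof. by apply/rowP => j; rewrite mxE enum_valK. Qed.

Lemma fnvE p d : fnv p 0 (enum_rank d) = p d.
Proof. by rewrite mxE enum_rankK. Qed.

Lemma eq_fnv p q : p =1 q <-> fnv p = fnv q.
Proof.
split=> [pq|/rowP pq d]; first by apply/rowP => j; rewrite !mxE pq.
by have := pq (enum_rank d); rewrite !fnvE.
Qed.

Lemma sum_enum (F : D -> K) : \sum_(j < #|D|) F (enum_val j) = \sum_d F d.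
Proof. by rewrite -(big_enum_val (A := D)); apply: eq_bigl. Qed.

Lemma fnv_mul p f : fnv p *m fn_mx f = fnv (p \o f).
Proof.
apply/rowP => j; rewrite !mxE.
under eq_bigr do rewrite !mxE.
rewrite (sum_enum (fun d => p d * (d == f (enum_val j))%:R)).
rewrite (bigD1 (f (enum_val j))) //= eqxx mulr1 big1 ?addr0 // => d /negbTE ->.
by rewrite mulr0.
Qed.

Lemma fnv_dot p q : (fnv p *m (fnv q)^T) 0 0 = \sum_d p d * q d.
Proof. by rewrite mxE -sum_enum; apply: eq_bigr => j _; rewrite !mxE. Qed.

Lemma eq_fn_mx f g : f =1 g -> fn_mx f = fn_mx g.
Proof. by move=> fg; apply/matrixP => i j; rewrite !mxE fg. Qed.

Lemma fn_mx_id : fn_mx id = 1%:M.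
Proof. by apply/matrixP => i j; rewrite !mxE (inj_eq enum_val_inj). Qed.

Lemma fn_mxM f g : fn_mx f *m fn_mx g = fn_mx (f \o g).
Proof.
apply/row_matrixP => i; rewrite row_mul -[row i (fn_mx f)]fnvK fnv_mul.
by apply/rowP => j; rewrite !mxE /= !mxE enum_rankK.
Qed.

Lemma fn_mxVr f : injective f -> fn_mx f *m (fn_mx f)^T = 1%:M.
Proof.
move=> f_inj; apply: mulmx1C; apply/matrixP => i j; rewrite !mxE.
under eq_bigr do rewrite !mxE.
rewrite (sum_enum (fun d =>
  (d == f (enum_val i))%:R * (d == f (enum_val j))%:R)).
rewrite (bigD1 (f (enum_val i))) //= eqxx mul1r (inj_eq f_inj).
rewrite (inj_eq enum_val_inj) big1 ?addr0 // => d /negbTE ->.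
by rewrite mul0r.
Qed.

Lemma sub_ker_fix n m (v : 'M[K]_(m, n)) (T : 'M_n) :
  (v <= kermx (T - 1%:M))%MS = (v *m T == v).
Proof. by rewrite sub_kermx mulmxBr mulmx1 subr_eq0. Qed.

(** The fixed vectors are the functions constant on the orbits of [f]. The orbit indicators, which
    are the rows of [B], form a basis; [S] evaluates a function at the orbit representatives. *)
Lemma rank_fix f :
  injective f -> \rank (kermx (fn_mx f - 1%:M)) = fcard f D.
Proof.
move=> f_inj; have sym := fconnect_sym f_inj.
pose R := [set d | d \in froots f].
have -> : fcard f D = #|R|.
  by apply: eq_card => d; rewrite !inE andbT.
pose B : 'M[K]_(#|R|, #|D|) :=
  \matrix_(i, j) (froot f (enum_val j) == enum_val i)%:R.
pose S : 'M[K]_(#|D|, #|R|) := \matrix_(j, i) (enum_val j == enum_val i)%:R.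
have rootR (i : 'I_#|R|) : froot f (enum_val i) = enum_val i.
  by have := enum_valP i; rewrite inE => /eqP.
have BS : B *m S = 1%:M.
  apply/matrixP => i k; rewrite !mxE.
  under eq_bigr do rewrite !mxE.
  rewrite (sum_enum (fun d =>
    (froot f d == enum_val i)%:R * (d == enum_val k)%:R)).
  rewrite (bigD1 (enum_val k)) //= eqxx mulr1 rootR (inj_eq enum_val_inj).
  by rewrite big1 ?addr0 1?eq_sym // => d /negbTE ->; rewrite mulr0.
have <- : \rank B = #|R| by apply/eqP/row_freeP; exists S.
apply: eqmx_rank; apply/andP; split.
  apply/rV_subP => v; rewrite sub_ker_fix => /eqP vf.
  have vroot d : v 0 (enum_rank (froot f d)) = v 0 (enum_rank d).
    have := connect_root (frel f) d; move/iter_findex <-.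
    elim: (findex _ _ _) => //= k <-; rewrite -{2}vf -[v in v *m _]fnvK fnv_mul.
    by rewrite fnvE.
  apply/submxP; exists (v *m S); apply/rowP => j; rewrite -mulmxA mxE.
  rewrite (bigD1 (enum_rank (froot f (enum_val j)))) //= vroot enum_valK.
  have jR : froot f (enum_val j) \in R by rewrite inE; apply: roots_root.
  rewrite mxE (bigD1 (enum_rank_in jR (froot f (enum_val j)))) //= !mxE.
  rewrite enum_rankK (enum_rankK_in jR) // !eqxx !mulr1 !big1 ?addr0 ?mulr1 //.
    move=> k kj; rewrite mxE big1 ?mulr0 // => i _; rewrite !mxE.
    have [<-|] := eqVneq (froot f (enum_val j)) (enum_val i); last by rewrite mulr0.
    rewrite mulr1; case: eqP => // E; move: kj.
    by rewrite -E enum_valK eqxx.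
  move=> i ij; rewrite !mxE enum_rankK; case: eqP => [E|]; last by rewrite mul0r.
  by case/eqP: ij; apply: enum_val_inj; rewrite (enum_rankK_in jR).
rewrite sub_ker_fix; apply/eqP/row_matrixP => i; rewrite row_mul.
rewrite -[row i B]fnvK fnv_mul; apply/eq_fnv => d /=; rewrite !mxE !enum_rankK.
by rewrite -(fingraph.rootP sym (fconnect1 f d)).
Qed.

End DartMatrices.

(** * The rank of the intersection form, in matrix terms *)

Section RadicalRank.
Variables (K : realFieldType) (n : nat) (T J : 'M[K]_n).
Hypotheses (TV : T *m T^T = 1%:M) (JV : J *m J = 1%:M) (Jt : J^T = J).
Hypothesis conn : \rank (kermx (T - 1%:M) :&: kermx (J - 1%:M))%MS = 1%N.

(** With [T] and [J] the operators of [rot] and [opp], [v *m C = 0] says that the jump [v *m T - v]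
    changes sign under [J]; so [P] is the space of potentials. *)
Let C := (T - 1%:M) *m (1%:M + J).
Let P := kermx C.

Lemma sub_pot m (v : 'M[K]_(m, n)) :
  (v <= P)%MS = (v *m T + v *m T *m J == v + v *m J).
Proof.
rewrite sub_kermx -[RHS]subr_eq0 /C mulmxA mulmxDr mulmx1 mulmxBr mulmx1.
by rewrite mulmxBl opprD addrACA.
Qed.

(** The orthogonal complement of a kernel is the image of the transpose: the columns of
    [cokermx A^T], transposed, lie in [kermx A]. *)
Lemma sub_perp_ker m (v : 'M[K]_(m, n)) (A : 'M[K]_n) :
  v *m (kermx A)^T = 0 -> (v <= A^T)%MS.
Proof.
move=> v0; rewrite submxE.
have /submxP[X XE] : ((cokermx A^T)^T <= kermx A)%MS.
  by rewrite sub_kermx -[A in _ *m A]trmxK -trmx_mul mulmx_coker trmx0.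
by rewrite -[cokermx _]trmxK XE trmx_mul mulmxA v0 mul0mx.
Qed.

(** Half of 1 + J is the projector onto the vectors fixed by [J]. *)
Lemma sub_im_inv m (v : 'M[K]_(m, n)) : (v <= (1%:M + J)%R)%MS = (v *m J == v).
Proof.
apply/submxP/eqP => [[w ->]|vJ].
  by rewrite -mulmxA mulmxDl JV mul1mx addrC.
exists (2^-1 *: v); rewrite mulmxDr mulmx1 -scalemxAl vJ -scalerDl.
by rewrite -[LHS]scale1r; congr (_ *: _); field.
Qed.

Let trC : C^T = (1%:M + J) *m (T^T - 1%:M).
Proof.
rewrite trmx_mul; congr (_ *m _); first by rewrite linearD /= trmx1 Jt.
by rewrite linearB /= trmx1.
Qed.

(** The transpose of [C] is T^T - 1 applied to the image of 1 + J. It kills there exactly the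
    vectors fixed by both [T] and [J], a line by [conn]. *)
Lemma rank_pot : (\rank P + \rank (1%:M + J)%R = n.+1)%N.
Proof.
have rC : (\rank C + 1 = \rank (1%:M + J)%R)%N.
  rewrite -mxrank_tr trC.
  rewrite -[RHS](mxrank_mul_ker _ (T^T - 1%:M)) -conn; congr (_ + _)%N.
  apply: eqmx_rank; apply/andP; split; apply/rV_subP => v;
    rewrite !sub_capmx !sub_ker_fix sub_im_inv => /andP[/eqP v1 /eqP v2].
    by rewrite v2 -[in X in X *m _]v1 -mulmxA TV mulmx1 !eqxx.
  by rewrite v1 -[in X in X *m _]v2 -mulmxA (mulmx1C TV) mulmx1 !eqxx.
rewrite -rC addn1 addnS /P mxrank_ker subnK //; exact: rank_leq_row.
Qed.

Lemma radical_pot :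
  (P :&: kermx ((T^T - T) *m P^T) :=: kermx (T - 1%:M) + kermx (T *m J - 1%:M))%MS.
Proof.
have PE := eqP (etrans (esym (sub_pot P)) (submx_refl P)).
have TtT := mulmx1C TV.
apply/eqmxP/andP; split.
  apply/rV_subP => v; rewrite sub_capmx sub_pot sub_kermx mulmxA.
  case/andP=> /eqP vP /eqP/sub_perp_ker/submxP[w wE].
  (* The identity [E] makes [u] constant around vertices, and the potential equation for [v] makes v
     - u/2 constant along faces. *)
  pose w' := w *m (1%:M + J); pose u := v + v *m T - w'.
  have w'J : w' *m J = w' by rewrite /w' -mulmxA mulmxDl JV mul1mx [J + _]addrC.
  have E : v - v *m T *m T = w' - w' *m T.
    have := congr1 (mulmx^~ T) wE.
    rewrite trC mulmxA -/w' /=.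
    by rewrite !mulmxBr !mulmxBl mulmx1 -!mulmxA TtT !mulmx1.
  have uT : u *m T = u.
    rewrite /u mulmxBl mulmxDl; apply/rowP => j; move/rowP/(_ j): E.
    by rewrite !mxE => E; lra.
  rewrite -[v](subrK (2^-1 *: u)) addrC; apply: addmx_sub_adds.
    by rewrite scalemx_sub // sub_ker_fix uT.
  rewrite sub_ker_fix mulmxA mulmxBl -scalemxAl uT mulmxBl -scalemxAl.
  have uJ : u *m J = v *m J + v *m T *m J - w' by rewrite /u mulmxBl mulmxDl w'J.
  apply/eqP/rowP => j; move/rowP/(_ j): vP; move/rowP/(_ j): uJ.
  by rewrite /u !mxE => E1 E2; lra.
rewrite addsmx_sub; apply/andP; split; apply/rV_subP => v;
  rewrite sub_ker_fix sub_capmx sub_pot sub_kermx => /eqP vE.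
  rewrite vE eqxx mulmxA mulmxBr vE -[in X in X *m T^T]vE -mulmxA TV mulmx1.
  by rewrite subrr mul0mx eqxx.
have vTJ : v *m T = v *m J.
  by rewrite -[in RHS]vE -!mulmxA JV mulmx1.
rewrite -mulmxA vE vTJ addrC eqxx /= mulmxA mulmxBr mulmxBl subr_eq0 vTJ.
(* The defining equation of potentials, transposed. *)
have PTJ : J *m (T^T *m P^T) = P^T + J *m P^T - T^T *m P^T.
  rewrite -[X in X *m (_ *m _)]Jt -!trmx_mul.
  have -> : P *m T *m J = P + P *m J - P *m T by rewrite -PE addrC addKr.
  by rewrite linearB linearD /= !trmx_mul Jt.
have e1 : v *m J *m (J *m P^T) = v *m P^T.
  by rewrite mulmxA -(mulmxA v) JV mulmx1.
have e2 : v *m J *m (T^T *m P^T) = v *m P^T.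
  by rewrite -vTJ mulmxA -(mulmxA v) TV mulmx1.
apply/eqP; rewrite -[in LHS]vE -!mulmxA PTJ mulmxA vTJ.
by rewrite mulmxBr mulmxDr e1 e2 addrK mulmxA.
Qed.

(** Subtract the dimension of the radical from that of [P]. The two summands of the radical meet in
    a line, since fixed by [T] and [T *m J] means fixed by [T] and [J]. *)
Lemma rank_form :
  (\rank (P *m (T^T - T) *m P^T) + \rank (kermx (T - 1%:M))
   + \rank (kermx (T *m J - 1%:M)) + \rank (1%:M + J)%R = n.+2)%N.
Proof.
have cap : (\rank (kermx (T - 1%:M) + kermx (T *m J - 1%:M))%MS + 1
  = \rank (kermx (T - 1%:M)) + \rank (kermx (T *m J - 1%:M)))%N.
  rewrite -mxrank_sum_cap -[in LHS]conn; congr (_ + _)%N.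
  apply: eqmx_rank; apply/andP; split; apply/rV_subP => v;
    rewrite !sub_capmx !sub_ker_fix mulmxA => /andP[/eqP vT].
    by rewrite vT => ->; rewrite !eqxx.
  by rewrite vT => ->; rewrite !eqxx.
have := mxrank_mul_ker P ((T^T - T) *m P^T).
by rewrite radical_pot mulmxA; have := rank_pot; lia.
Qed.

End RadicalRank.

(** * The intersection form of an embedded graph and Euler's formula *)

Section IntersectionForm.
Variable G : egraph.
Implicit Types (p q : dart G -> rat) (S : {set dart G}) (d e : dart G).

(* A function p on the darts is read as a potential on the corners, p d being
   its value at the corner that precedes d; delta p d is the jump across d. *)
Definition delta p d : rat := p (rot d) - p d.

(* The potentials whose jump is a 1-chain supported in S.  These chains are the
   cycles supported in S, by [exists_delta] below. *)
Definition pot S p : Prop :=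
  (forall d, delta p (opp d) = - delta p d) /\ (forall d, d \notin S -> delta p d = 0).

(* Twice the intersection number of the cycles delta p and delta q. *)
Definition bform p q : rat := \sum_d (p d * q (rot d) - p (rot d) * q d).

(** For even [r], this says that the form on the cycles supported in [S] has rank at least [r]. *)
Definition hasgram S r : Prop :=
  exists2 p : 'I_r -> dart G -> rat, forall i, pot S (p i) & gram bform p \in unitmx.

Lemma bform_skew p q : bform p q = - bform q p.
Proof. by rewrite /bform -sumrN; apply: eq_bigr => d _; ring. Qed.

Lemma reindex_rot (F : dart G -> rat) : \sum_d F (rot d) = \sum_d F d.
Proof. by rewrite [RHS](reindex_inj (@rot_inj G)). Qed.

(** Adding the vanishing sum of p q (rot d) - p q (d) shows that only the jump of [q] matters; by
    skewness the same holds for [p]. *)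
Lemma bform_delta p q : bform p q = \sum_d (p d + p (rot d)) * delta q d.
Proof.
have := reindex_rot (fun d => p d * q d) => /eqP.
rewrite -subr_eq0 -sumrB => /eqP E; rewrite -[LHS]addr0 -[X in _ + X]E -big_split /=.
by apply: eq_bigr => d _; rewrite /delta; ring.
Qed.

Lemma pot_sub S S' p : S \subset S' -> pot S p -> pot S' p.
Proof.
by move=> /subsetP sS [pN pS]; split=> // d dS'; apply/pS/(contraNN (sS d)).
Qed.

Lemma hasgram_sub S S' r : S \subset S' -> hasgram S r -> hasgram S' r.
Proof. by move=> sS [p pS up]; exists p => // i; apply: pot_sub (pS i). Qed.

Lemma hasgram_drop S r : hasgram S r.+2 -> hasgram S r.
Proof.
case=> p pS up; have [f uf] := skew_drop2 (gram_skew bform_skew p) up.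
by exists (p \o f) => [i|]; [apply: pS | rewrite gram_sub].
Qed.

Lemma hasgram_even S r : hasgram S r -> ~~ odd r.
Proof. by case=> p _; apply: skew_unit_even; apply: gram_skew bform_skew _ p. Qed.

Lemma hasgram_le S r s : hasgram S s -> (r.*2 <= s)%N -> hasgram S r.*2.
Proof.
elim/ltn_ind: s => s IH Hs; rewrite leq_eqVlt => /orP[/eqP -> //|lt].
have := hasgram_even Hs; case: s => [|[|s]] in IH Hs lt * => // odds.
by apply: (IH s) => //; [apply: hasgram_drop | move: odds lt => /=; lia].
Qed.

Lemma hasgram0 S : hasgram S 0.
Proof. by exists (fun i _ => 0) => [[] //|]; rewrite unitmxE det_mx00 unitr1. Qed.

Lemma isolated_count :
  (#|vert G| = fcard (@rot G) (dart G) + #|[set v : vert G | [forall d, src d != v]]|)%N.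
Proof.
set I := [set v | _]; rewrite -(cardsC I) addnC; congr (_ + _)%N.
have sym := fconnect_sym (@rot_inj G).
have -> : ~: I = @src G @: froots (@rot G).
  apply/setP => v; rewrite !inE negb_forall; apply/existsP/imsetP.
    case=> d; rewrite negbK => /eqP <-; exists (froot rot d).
      exact: roots_root.
    by apply/esym/eqP; rewrite eq_sym -rotP; apply: connect_root.
  by case=> d _ ->; exists d; rewrite negbK.
rewrite card_in_imset => [|d e /eqP dr /eqP er sde].
  by apply: eq_card => d; rewrite !inE andbT.
by rewrite -dr -er; apply/(fingraph.rootP sym); rewrite rotP sde.
Qed.

Lemma nedges_double : (#|dart G| = (nedges G).*2)%N.
Proof.
rewrite -muln2 /nedges fcard_order_set //.
- exact: inv_inj (@oppK G).
- apply/subsetP => d _; rewrite inE; apply/eqP.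
  rewrite /order; rewrite -[RHS](_ : #|[set d; opp d]| = 2%N).
    apply: eq_card => e; rewrite !inE; apply/idP/idP.
      move/iter_findex <-; elim: (findex _ _ _) => [|k] /=; first by rewrite eqxx.
      by case/orP=> /eqP ->; rewrite ?oppK eqxx ?orbT.
    by case/orP=> /eqP ->; rewrite ?connect0 ?fconnect1.
  by rewrite cards2 eq_sym opp_neq.
Qed.

Hypothesis conn : connected_egraph G.

Lemma connected_const p :
  p \o rot =1 p -> p \o opp =1 p -> forall d e, p d = p e.
Proof.
move=> pr po.
have pv d e : src d = src e -> p d = p e.
  move/eqP; rewrite -rotP => /iter_findex <-.
  by elim: (findex _ _ _) => //= k ->; rewrite -[LHS]pr.
move=> d e; have /connectP[s] := conn.2 (src d) (src e).
elim: s d => [|v s IH] d /=; first by move=> _ E; apply: pv.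
case/andP=> /existsP[f /andP[/eqP fd /eqP fv]] sP sE.
rewrite -(pv f) // -[LHS]po; apply: IH; rewrite /= fv //.
Qed.

Lemma connected_isolated (d : dart G) : [set v : vert G | [forall d, src d != v]] = set0.
Proof.
apply/setP => v; rewrite !inE; apply/negbTE; rewrite negb_forall; apply/existsP.
have /connectP[s] := conn.2 v (src d).
case: s => [_ E|u s /= /andP[/existsP[e /andP[E _]] _] _].
  by exists d; rewrite negbK E.
by exists e; rewrite negbK E.
Qed.

(** Here [r] is the rank of the form on all potentials: [rank_form], with 2|E| darts, gives the
    equation, and a maximal principal minor gives the cycles. *)
Lemma euler_form : exists r, [/\ (#|vert G| + nfacial G + r = nedges G + 2)%N,
  hasgram setT r & forall s, hasgram setT s -> (s <= r)%N].
Proof.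
(* Without darts the graph is one isolated vertex, with its facial walk of length 0, and r = 0. *)
case: (pickP (dart G)) => [d0 _|D0]; last first.
  have card0 (a : pred (dart G)) : #|a| = 0%N.
    by apply: eq_card0 => d; have := D0 d.
  exists 0%N; split; last first.
  - case=> // s [p _ ]; have -> : gram bform p = 0.
      by apply/matrixP => i j; rewrite !mxE /bform big_pred0 // => d; have := D0 d.
    by rewrite unitmxE det0 unitr0.
  - exact: hasgram0.
  rewrite /nedges /nfacial addn0.
  have E (f : dart G -> dart G) : fcard f (dart G) = 0%N by exact: card0.
  have V1 : #|vert G| = 1%N.
    apply/eqP/card1P => /=; have /card_gt0P[v _] := conn.1.
    exists v => u; rewrite !inE; have /connectP[[|w s] /=] := conn.2 v u.
      by move=> _ ->; rewrite eqxx.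
    by case/andP=> /existsP[d]; have := D0 d.
  by have := isolated_count; rewrite !E V1 !add0n => <-.
set T := fn_mx rat (@rot G); set J := fn_mx rat (@opp G).
have TV : T *m T^T = 1%:M by apply: fn_mxVr; apply: rot_inj.
have JV : J *m J = 1%:M.
  by rewrite fn_mxM -fn_mx_id; apply: eq_fn_mx => d /=; rewrite oppK.
have Jt : J^T = J.
  have := fn_mxVr rat (inv_inj (@oppK G)); rewrite -/J => E.
  by rewrite -[LHS]mul1mx -JV -mulmxA E mulmx1.
have conn1 : \rank (kermx (T - 1%:M) :&: kermx (J - 1%:M))%MS = 1%N.
  rewrite -[RHS](_ : \rank (fnv (fun _ : dart G => 1 : rat)) = 1%N); last first.
    rewrite rank_rV; case: eqP => // /rowP/(_ (enum_rank d0)).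
    by rewrite fnvE mxE => /eqP; rewrite oner_eq0.
  apply: eqmx_rank; apply/andP; split; last first.
    by rewrite sub_capmx !sub_ker_fix !fnv_mul !eqxx.
  apply/rV_subP => v; rewrite sub_capmx !sub_ker_fix -[v]fnvK !fnv_mul.
  set p := fun d => _ => /andP[/eqP/eq_fnv pr /eqP/eq_fnv po].
  apply/submxP; exists (p d0)%:M; rewrite mul_scalar_mx.
  apply/rowP => j; rewrite !mxE mulr1.
  exact: (connected_const pr po).
set C := (T - 1%:M) *m (1%:M + J); set P := kermx C.
set M := P *m (T^T - T) *m P^T.
have bE p q : bform p q = (fnv p *m (T^T - T) *m (fnv q)^T) 0 0.
  rewrite mulmxBr mulmxBl -mulmxA -trmx_mul !fnv_mul [RHS]mxE [X in _ + X]mxE.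
  by rewrite !fnv_dot -sumrB.
have potP p : pot setT p <-> (fnv p <= P)%MS.
  rewrite /P sub_pot !fnv_mul; split=> [[pN _]|].
    apply/eqP/rowP => j; have := pN (enum_val j).
    by rewrite !mxE /delta /=; lra.
  move/eqP/rowP => E; split=> [d|d]; last by rewrite inE.
  by have := E (enum_rank d); rewrite !mxE !enum_rankK /delta /=; lra.
exists (\rank M); split.
- have := rank_form TV JV Jt conn1; rewrite -/C -/P -/M.
  rewrite fn_mxM !rank_fix; first last.
  + exact: rot_inj.
  + by move=> d e /= /rot_inj/(inv_inj (@oppK G)).
  have -> : \rank (1%:M + J)%R = nedges G.
    rewrite -[RHS](rank_fix rat (inv_inj (@oppK G))); apply: eqmx_rank.
    by apply/andP; split; apply/rV_subP => v; rewrite sub_im_inv // sub_ker_fix.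
  rewrite isolated_count /nfacial (connected_isolated d0) cards0 !addn0.
  rewrite -[fcard (@rot G \o @opp G) _]/(fcard (@face G) (dart G)).
  by have := nedges_double; lia.
- have skM : M^T = - M.
    rewrite /M (trmx_mul (P *m _)) (trmx_mul P) trmxK [(_ - _)^T]linearB /=.
    by rewrite [T^T^T]trmxK -[T - T^T]opprB mulNmx mulmxN mulmxA.
  have [f uf] := skew_max_minor skM.
  pose p i d := P (f i) (enum_rank d); have pE i : fnv (p i) = row (f i) P.
    by apply/rowP => j; rewrite [LHS]mxE [RHS]mxE /p enum_valK.
  exists p => [i|]; first by apply/potP; rewrite pE row_sub.
  suff -> : gram bform p = mxsub f f M by [].
  apply/matrixP => i j; rewrite mxE bE !pE [RHS]mxE /M -row_mul.
  by rewrite [LHS]mxE [RHS]mxE; apply: eq_bigr => k _; congr (_ * _); rewrite !mxE.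
(* Every Gram matrix of potentials factors as X M X^T, so its rank is at most that of [M]. *)
move=> s [p ps up].
pose Q : 'M_(s, _) := \matrix_i fnv (p i).
have /submxP[X QE] : (Q <= P)%MS.
  by apply/row_subP => i; rewrite rowK; apply/potP.
have gE : gram bform p = X *m (M *m X^T).
  have -> : X *m (M *m X^T) = Q *m (T^T - T) *m Q^T.
    by rewrite QE trmx_mul /M !mulmxA.
  apply/matrixP => i j; rewrite mxE bE !mxE; apply: eq_bigr => k _.
  by rewrite !mxE; congr (_ * _); apply: eq_bigr => l _; rewrite !mxE.
have <- : \rank (gram bform p) = s by apply: mxrank_unit.
rewrite gE; apply: leq_trans (mxrankM_maxr _ _) _; exact: mxrankM_maxl.
Qed.

End IntersectionForm.

Arguments bform {G} p q.

(** * Cycles as jumps of potentials *)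

Section Cycles.
Variable G : egraph.
Implicit Types (p q x : dart G -> rat) (d e : dart G) (v : vert G).

Lemma src_rot d : src (rot d) = src d.
Proof. by apply/esym/eqP; rewrite -rotP fconnect1. Qed.

Lemma sum_delta p v : \sum_(d | src d == v) delta p d = 0.
Proof.
rewrite sumrB [X in _ - X](reindex_inj (@rot_inj G)) /=.
by under [X in _ - X]eq_bigl do rewrite src_rot; rewrite subrr.
Qed.

(** A chain without boundary is orthogonal to the functions constant around vertices, that is, to
    the kernel of T - 1. Hence it has the form w (T^T - 1), the jump of - w T^T. *)
Lemma exists_delta x :
  (forall v, \sum_(d | src d == v) x d = 0) -> exists p, delta p =1 x.
Proof.
move=> x0; pose T := fn_mx rat (@rot G).
have TV : T^T *m T = 1%:M by apply: mulmx1C; apply: fn_mxVr; apply: rot_inj.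
have /sub_perp_ker/submxP[w wE] : fnv x *m (kermx (T - 1%:M))^T = 0.
  apply/rowP => j; rewrite [RHS]mxE.
  have row_dot (N : 'M_#|dart G|) :
    (fnv x *m N^T) 0 j = (fnv x *m (row j N)^T) 0 0.
    by rewrite [LHS]mxE [RHS]mxE; apply: eq_bigr => i _; congr (_ * _); rewrite !mxE.
  rewrite row_dot.
  have : (row j (kermx (T - 1%:M)) <= kermx (T - 1%:M))%MS by apply: row_sub.
  rewrite sub_ker_fix -[row j _]fnvK fnv_mul; set u := fun d => _.
  move=> /eqP/eq_fnv /= ur; rewrite fnv_dot (partition_big src xpredT) //=.
  apply: big1 => v _; case: (pickP (fun d => src d == v)) => [d /eqP dv|no].
    rewrite -[RHS](mul0r (u d)) -[in RHS](x0 v) mulr_suml; apply: eq_bigr => e /eqP ev.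
    congr (_ * _); have: fconnect rot d e by rewrite rotP dv ev.
    by move/iter_findex <-; elim: (findex _ _ _) => //= k <-; exact: ur.
  by rewrite big_pred0 // => d; rewrite no.
pose p d := - (w *m T^T) 0 (enum_rank d).
have pE : fnv p = - (w *m T^T).
  by apply/rowP => j; rewrite !mxE /p enum_valK !mxE.
exists p; apply/eq_fnv; rewrite wE.
have -> : fnv (delta p) = fnv p *m T - fnv p.
  by rewrite fnv_mul; apply/rowP => j; rewrite !mxE.
rewrite pE mulNmx -mulmxA TV mulmx1 opprK [(_ - _)^T]linearB /= trmx1.
by rewrite mulmxBr mulmx1 addrC.
Qed.

Lemma eq_bform p p' q q' :
  delta p =1 delta p' -> delta q =1 delta q' -> bform p q = bform p' q'.
Proof.
have E p0 q0 q1 : delta q0 =1 delta q1 -> bform p0 q0 = bform p0 q1.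
  by move=> E; rewrite !bform_delta; apply: eq_bigr => d _; rewrite E.
by move=> Ep Eq; rewrite (E _ _ _ Eq) bform_skew (E _ _ _ Ep) -bform_skew.
Qed.

End Cycles.

(** * Intersection numbers in a subgraph *)

Section Induced.
Variables (G : egraph) (S : subgraph G).

(** The darts passed between [d] and its first return lie outside [S], where [p] does not jump. *)
Lemma first_return_const (p : dart G -> rat) d :
  (forall e, e \notin sdarts S -> delta p e = 0) ->
  p (first_return rot (sdarts S) d) = p (rot d).
Proof.
move=> p0; rewrite /first_return.
have: (wait rot (sdarts S) d <= wait rot (sdarts S) d)%N by [].
elim: {1 3}(wait _ _ _) => //= k IH lt; rewrite -IH ?(ltnW lt) //.
apply/eqP; rewrite -subr_eq0; apply/eqP; apply: (p0 (iter k.+1 rot d)).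
have := before_find 0 lt; rewrite nth_iota ?add0n => [->//|].
by apply: leq_trans lt (leq_trans (find_size _ _) _); rewrite size_iota.
Qed.

Lemma bform_induced (p q : dart G -> rat) : pot (sdarts S) p -> pot (sdarts S) q ->
  bform (G := induced S) (p \o val) (q \o val) = bform p q.
Proof.
move=> [_ p0] [_ q0]; rewrite !bform_delta.
rewrite [RHS](bigID (mem (sdarts S))) /= [X in _ + X]big1 => [|d dS]; last first.
  by rewrite q0 // mulr0.
rewrite addr0 [RHS]big_sub /=; apply: eq_bigr => d _.
by rewrite /delta /= !first_return_const.
Qed.

Lemma pot_induced (p : dart G -> rat) : pot (sdarts S) p ->
  pot (G := induced S) setT (p \o val).
Proof.
move=> [pN p0]; split=> d; last by rewrite inE.
by have := pN (val d); rewrite /delta /= !first_return_const.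
Qed.

(** The cycle [delta p], extended by zero, still has no boundary, so it is a jump in [G]. The new
    potential restricts to one with the same jump as [p], which suffices for the form by
    [eq_bform]. *)
Lemma pot_extend (p : dart (induced S) -> rat) : pot setT p ->
  exists2 p' : dart G -> rat,
    pot (sdarts S) p' & delta (G := induced S) (p' \o val) =1 delta p.
Proof.
move=> [pN _]; pose x d := oapp (delta p) 0 (insub d).
have [v|p' p'E] := @exists_delta G x.
  rewrite (bigID (mem (sdarts S))) /= [X in _ + X]big1 => [|d /andP[_ dS]]; last first.
    by rewrite /x insubN.
  rewrite addr0; under eq_bigl do rewrite andbC.
  rewrite big_sub_cond /=; case: (boolP (v \in sverts S)) => vS.
    rewrite -[RHS](sum_delta p (Sub v vS)); apply: eq_big => [d|d _].
      by rewrite -val_eqE.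
    by rewrite /x valK.
  apply: big1 => d /eqP dv; case/negP: vS; rewrite -dv.
  exact: sdarts_src (valP d).
have p'0 e : e \notin sdarts S -> delta p' e = 0 by move=> eS; rewrite p'E /x insubN.
exists p'.
  split=> // d; case: (boolP (d \in sdarts S)) => dS; last first.
    rewrite !p'0 ?oppr0 //; apply: contra dS => dS; rewrite -[d]oppK.
    exact: sdarts_opp.
  have := pN (Sub d dS); rewrite !p'E /x insubT ?sdarts_opp // => oS.
  rewrite insubT /= => <-; congr (delta p _); exact: val_inj.
move=> d; rewrite {1}/delta /= first_return_const //.
by have := p'E (val d); rewrite /x valK.
Qed.

Lemma hasgram_induced r :
  hasgram (G := induced S) setT r <-> hasgram (sdarts S) r.
Proof.
split=> [[p pS up]|[p pS up]].
  have /choice[q qE] i : exists q, pot (sdarts S) q /\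
      delta (G := induced S) (q \o val) =1 delta (p i).
    by have [q] := pot_extend (pS i); exists q.
  exists q => [i|]; first by case: (qE i).
  suff -> : gram bform q = gram bform p by [].
  apply/matrixP => i j; rewrite !mxE.
  have [[qi di] [qj dj]] := (qE i, qE j).
  by rewrite -(bform_induced qi qj); apply: eq_bform.
exists (fun i => p i \o val) => [i|]; first exact: pot_induced.
suff -> : gram (bform (G := induced S)) (fun i => p i \o val) = gram bform p by [].
by apply/matrixP => i j; rewrite !mxE bform_induced.
Qed.

End Induced.

Lemma hasgram_iso (X Y : egraph) r :
  egraph_iso X Y -> hasgram (G := X) setT r -> hasgram (G := Y) setT r.
Proof.
move=> [_ [f [_ [h fK hK] _ fo fr]]] [p pS up].
have hr d : h (rot d) = rot (h d) by rewrite -{1}[d]hK fr fK.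
have ho d : h (opp d) = opp (h d) by rewrite -{1}[d]hK fo fK.
exists (fun i => p i \o h) => [i|].
  split=> d; last by rewrite inE.
  by have [pN _] := pS i; have := pN (h d); rewrite /delta /= !hr ho.
suff -> : gram bform (fun i => p i \o h) = gram bform p by [].
apply/matrixP => i j; rewrite !mxE /bform [RHS](reindex h) /=; last first.
  by exists f => d _.
by apply: eq_bigr => d _; rewrite !hr.
Qed.

(** * Genus in terms of the intersection form *)

Section Genus.
Variable G : egraph.

(** The cycles carry over to the ambient cellular graph, where the form has rank 2k by
    [euler_form]. *)
Lemma embeds_in_ge k r :
  embeds_in k G -> hasgram (G := G) setT r -> (r <= k.*2)%N.
Proof.
move=> [M [S [[connM eulerM] iso]]] /(hasgram_iso iso)/hasgram_induced Hr.
have [s [sE _ sP]] := euler_form connM.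
apply: leq_trans (sP _ (hasgram_sub (subsetT _) Hr)) _.
by rewrite -(leq_add2l (#|vert M| + nfacial M)) sE eulerM.
Qed.

Lemma subgraphb_full : subgraphb ([set: vert G], [set: dart G]).
Proof. by apply/forall_inP => d _; rewrite !inE. Qed.

Definition full : subgraph G := Sub (setT, setT) subgraphb_full.

Lemma iso_full : egraph_iso G (induced full).
Proof.
have vT v : v \in sverts full by rewrite inE.
have dT d : d \in sdarts full by rewrite inE.
exists (fun v => Sub v (vT v)), (fun d => Sub d (dT d)); split.
- by exists val => [v|v]; [rewrite SubK | apply: val_inj; rewrite SubK].
- by exists val => [v|v]; [rewrite SubK | apply: val_inj; rewrite SubK].
- by move=> d; apply: val_inj.
- by move=> d; apply: val_inj.
(* The search range is nonempty and its first index succeeds, so the first return is [rot d]. *)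
move=> d; apply: val_inj; rewrite /= /first_return /wait.
have := order_gt0 (@rot G) d; case: (order _ d) => //= n _.
by rewrite inE.
Qed.

Lemma embeds_in_self : connected_egraph G ->
  exists2 k, embeds_in k G & hasgram (G := G) setT k.*2.
Proof.
move=> conn; have [r [rE Hr _]] := euler_form conn.
have rk : r = r./2.*2.
  by rewrite -[LHS]odd_double_half (negbTE (hasgram_even Hr)).
exists r./2; last by rewrite -rk.
by exists G, full; split; [split; rewrite // -rk | exact: iso_full].
Qed.

Lemma genP : connected_egraph G ->
  embeds_in (gen G) G /\ forall j, embeds_in j G -> (gen G <= j)%N.
Proof.
move=> conn; rewrite /gen.
(* The default 0 is excluded: [G] embeds cellularly in some surface by [embeds_in_self], so a least
   genus exists. *)
apply: (@classical_sets.xgetPex nat 0%N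
  (fun k => embeds_in k G /\ forall j, embeds_in j G -> (k <= j)%N)).
have [k0 k0P _] := embeds_in_self conn.
have ex : exists k, `[< embeds_in k G >] by exists k0; apply/asboolP.
exists (ex_minn ex); case: ex_minnP => k /asboolP kP kmin.
by split=> // j jP; apply: kmin; apply/asboolP.
Qed.

Lemma gen_gtP g : connected_egraph G ->
  (g < gen G)%N <-> hasgram (G := G) setT g.+1.*2.
Proof.
move=> conn; have [gP gmin] := genP conn; split=> [lt|/(embeds_in_ge gP)].
  have [k kP Hk] := embeds_in_self conn.
  by apply: hasgram_le Hk _; rewrite leq_double (leq_trans lt) ?gmin.
by rewrite leq_double.
Qed.

End Genus.

(** * 1-chains and their boundaries *)

Section Chains.
Variable G : egraph.
Implicit Types (x y : dart G -> rat) (S : {set dart G}) (d e : dart G).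
Implicit Types (u v w : vert G) (H : subgraph G).

Definition chain S x : Prop :=
  (forall d, x (opp d) = - x d) /\ (forall d, d \notin S -> x d = 0).

Definition bd x v : rat := \sum_(d | src d == v) x d.

Lemma chain_sub S S' x : S \subset S' -> chain S x -> chain S' x.
Proof.
by move=> /subsetP sS [xN xS]; split=> // d dS'; apply/xS/(contraNN (sS d)).
Qed.

Lemma chainB S x y : chain S x -> chain S y -> chain S (fun d => x d - y d).
Proof.
move=> [xN x0] [yN y0]; split=> d; first by rewrite xN yN opprB opprK addrC.
by move=> dS; rewrite x0 ?y0 ?subrr.
Qed.

Lemma chainD S x y : chain S x -> chain S y -> chain S (fun d => x d + y d).
Proof.
move=> [xN x0] [yN y0]; split=> d; first by rewrite xN yN opprD.
by move=> dS; rewrite x0 ?y0 ?addr0.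
Qed.

Lemma chain_sum S (I : finType) (P : pred I) (a : I -> rat) (x : I -> dart G -> rat) :
  (forall i, P i -> chain S (x i)) -> chain S (fun d => \sum_(i | P i) a i * x i d).
Proof.
move=> xS; split=> d.
  by rewrite -sumrN; apply: eq_bigr => i /xS[xN _]; rewrite xN mulrN.
by move=> dS; apply: big1 => i /xS[_ x0]; rewrite x0 ?mulr0.
Qed.

Lemma bdB x y v : bd (fun d => x d - y d) v = bd x v - bd y v.
Proof. exact: sumrB. Qed.

Lemma bdD x y v : bd (fun d => x d + y d) v = bd x v + bd y v.
Proof. exact: big_split. Qed.

Lemma bd_sum (I : finType) (P : pred I) (a : I -> rat) (x : I -> dart G -> rat) v :
  bd (fun d => \sum_(i | P i) a i * x i d) v = \sum_(i | P i) a i * bd (x i) v.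
Proof. by rewrite /bd exchange_big; apply: eq_bigr => i _; rewrite mulr_sumr. Qed.

Lemma sum_bd S x : chain S x -> \sum_v bd x v = 0.
Proof.
move=> [xN _]; have -> : \sum_v bd x v = \sum_d x d.
  by rewrite [RHS](partition_big src xpredT).
have : \sum_d x d = - \sum_d x d.
  rewrite {1}(reindex_inj (inv_inj (@oppK G))) -sumrN.
  by apply: eq_bigr => d _; rewrite xN.
by move/eqP; rewrite -addr_eq0 -mulr2n mulrn_eq0 => /eqP.
Qed.

Lemma path_chain H u v : connected_egraph (induced H) ->
  u \in sverts H -> v \in sverts H ->
  exists2 x, chain (sdarts H) x & forall w, bd x w = (w == v)%:R - (w == u)%:R.
Proof.
move=> [_ conn] uH vH; have /connectP[s] := conn (Sub u uH) (Sub v vH).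
elim: s u uH => [|u' s IH] u uH /=.
  move=> _ /(congr1 val) /= ->; exists (fun=> 0).
    by split=> // d; rewrite oppr0.
  by move=> w; rewrite subrr [LHS]big1.
case/andP=> /existsP[e /andP[/eqP eu /eqP eu']] sP sE.
have {}eu : src (val e) = u by move/(congr1 val): eu.
have {}eu' : src (opp (val e)) = val u' by move/(congr1 val): eu'.
case: u' eu' sP sE => u' u'H /= eu' sP sE.
have [x xH xE] := IH u' u'H sP sE.
(* Since [bd] sums over outgoing darts, [y] has boundary u - u'; subtracting it from [x] moves the
   start of the path from u' to u. *)
pose y d : rat := (d == val e)%:R - (d == opp (val e))%:R.
have bd1 e' w : bd (fun d => (d == e')%:R) w = (w == src e')%:R.
  rewrite /bd; have [->|wN] := eqVneq w (src e').
    by rewrite (bigD1 e') //= eqxx big1 ?addr0 // => d /andP[_ /negbTE ->].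
  rewrite big1 // => d /eqP dw; case: eqP => // de; case/eqP: wN.
  by rewrite -dw de.
exists (fun d => x d - y d).
  apply: chainB => //; split=> d; rewrite /y.
    by rewrite opprB (inv_eq (@oppK G)) (can_eq (@oppK G)).
  move=> dH; case: eqP => [E|_]; first by rewrite E (valP e) in dH.
  by case: eqP => [E|_]; rewrite ?subrr // E sdarts_opp ?(valP e) in dH *.
move=> w; rewrite !bdB xE !bd1 eu eu'; ring.
Qed.

End Chains.

(** * Generating the cycles of a cluster by those of few members *)

Section Cluster.
Variables (G : egraph) (F : {set subgraph G}) (A : subgraph G).
Hypothesis F_conn : forall H, H \in F -> connected_egraph (induced H).
Hypothesis F_disj : forall H K, H \in F -> K \in F -> H != K ->
  [disjoint sdarts H & sdarts K].
Hypothesis AF : A \in F.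
Hypothesis anchor : forall H, H \in F -> ~~ [disjoint sverts A & sverts H].

Lemma connect_member (F' : {set subgraph G}) H (u v : vert (induced (union F'))) :
  H \in F' -> connected_egraph (induced H) ->
  val u \in sverts H -> val v \in sverts H -> connect (@adj _) u v.
Proof.
move=> HF' [_ conn] uH vH; have /connectP[s] := conn (Sub (val u) uH) (Sub (val v) vH).
elim: s u uH => [|u' s IH] u uH /=.
  by move=> _ /(congr1 val) /= E; rewrite (val_inj E : v = u) connect0.
case/andP=> /existsP[e /andP[/eqP eu /eqP eu']] sP sE.
have {}eu : src (val e) = val u by move/(congr1 val): eu.
have {}eu' : src (opp (val e)) = val u' by move/(congr1 val): eu'.
case: u' eu' sP sE => u' u'H /= eu' sP sE.
have eF' : val e \in sdarts (union F').
  by apply/bigcupP; exists H => //; apply: valP.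
have u'F' : u' \in sverts (union F') by apply/bigcupP; exists H.
apply: connect_trans (IH (Sub u' u'F') u'H sP sE).
apply: connect1; apply/existsP; exists (Sub (val e) eF').
by rewrite -!val_eqE /= eu eu' !eqxx.
Qed.

(** Each vertex reaches [A] inside its own member, and [A] is connected. *)
Lemma connected_union (F' : {set subgraph G}) :
  F' \subset F -> A \in F' -> connected_egraph (induced (union F')).
Proof.
move=> /subsetP sF AF'.
have memU H v : H \in F' -> v \in sverts H -> v \in sverts (union F').
  by move=> HF' vH; apply/bigcupP; exists H.
split.
  have /card_gt0P[v _] := (F_conn AF).1.
  by apply/card_gt0P; exists (Sub (val v) (memU _ _ AF' (valP v))).
have meetA (u : vert (induced (union F'))) : exists2 a : vert (induced (union F')),
    val a \in sverts A & connect (@adj _) u a /\ connect (@adj _) a u.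
  have /bigcupP[H HF' uH] := valP u.
  have := anchor (sF _ HF'); rewrite -setI_eq0 => /set0Pn[a].
  rewrite inE => /andP[aA aH]; exists (Sub a (memU _ _ AF' aA)) => //.
  by split; apply: (connect_member HF' (F_conn (sF _ HF'))).
move=> u v; have [a aA [ua _]] := meetA u; have [b bA [_ bv]] := meetA v.
apply: connect_trans ua (connect_trans _ bv).
exact: (connect_member AF' (F_conn AF)).
Qed.

(* Let sigma H v be a chain in A u H from a base vertex a0 of A to v, with
   boundary v - a0.  Write the cycle x as the sum of its restrictions x_H to the
   members of F.  Subtracting from x_H the combination of the sigma H v given by
   its boundary leaves a cycle in A u H; the sigma H v with the same v differ by
   cycles in A u H u H', and their total coefficient is bd x v = 0. *)
Lemma cycles_generated (c x : dart G -> rat) :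
  (forall H H', H \in F -> H' \in F -> forall y,
     chain (sdarts A :|: sdarts H :|: sdarts H') y -> (forall v, bd y v = 0) ->
     \sum_d c d * y d = 0) ->
  chain (sdarts (union F)) x -> (forall v, bd x v = 0) -> \sum_d c d * x d = 0.
Proof.
move=> Hc [xN x0] xbd; pose lam (y : dart G -> rat) := \sum_d c d * y d.
have lamB y z : lam (fun d => y d - z d) = lam y - lam z.
  by rewrite -sumrB; apply: eq_bigr => d _; rewrite mulrBr.
have lam_sum (I : finType) (P : pred I) (a : I -> rat) (y : I -> dart G -> rat) :
    lam (fun d => \sum_(i | P i) a i * y i d) = \sum_(i | P i) a i * lam (y i).
  rewrite /lam; under eq_bigr do rewrite mulr_sumr.
  rewrite exchange_big; apply: eq_bigr => i _; rewrite mulr_sumr.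
  by apply: eq_bigr => d _; rewrite mulrCA.
have [a0 a0A] : exists v, v \in sverts A.
  by have /card_gt0P[v _] := (F_conn AF).1; exists (val v); apply: valP.
have /choice[sg sgP] : forall Hv : subgraph G * vert G,
    exists y : dart G -> rat, Hv.1 \in F -> Hv.2 \in sverts Hv.1 ->
      chain (sdarts A :|: sdarts Hv.1) y /\
      forall w, bd y w = (w == Hv.2)%:R - (w == a0)%:R.
  move=> [H v] /=.
  case: (boolP (H \in F)) => HF; last by exists (fun=> 0).
  case: (boolP (v \in sverts H)) => vH; last by exists (fun=> 0).
  have := anchor HF; rewrite -setI_eq0 => /set0Pn[a].
  rewrite inE => /andP[aA aH].
  have [y yA yE] := path_chain (F_conn AF) a0A aA.
  have [z zH zE] := path_chain (F_conn HF) aH vH.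
  exists (fun d => y d + z d) => _ _; split.
    by apply: chainD; [apply: chain_sub yA | apply: chain_sub zH];
      rewrite ?subsetUl ?subsetUr.
  by move=> w; rewrite bdD yE zE; ring.
(* One fixed member through each v serves as reference; the default [A] is taken only when no member
   contains v. *)
pose hv v := odflt A [pick H in F | v \in sverts H].
have hvP v H : H \in F -> v \in sverts H -> hv v \in F /\ v \in sverts (hv v).
  rewrite /hv; case: pickP => [K /andP[KF vK]|/(_ H)] //=.
  by move=> no HF vH; rewrite HF vH in no.
pose xr H d := if d \in sdarts H then x d else 0.
have xrP H : chain (sdarts H) (xr H).
  split=> [d|d /negbTE]; last by rewrite /xr => ->.
  rewrite /xr; have -> : (opp d \in sdarts H) = (d \in sdarts H).
    by apply/idP/idP => /sdarts_opp; rewrite ?oppK.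
  by case: ifP; rewrite ?oppr0.
(* By edge-disjointness a dart of the union lies in exactly one member. The factor 1 fits [lam_sum]
   and [bd_sum]. *)
have xE d : x d = \sum_(H in F) 1 * xr H d.
  under eq_bigr do rewrite mul1r.
  case: (boolP (d \in sdarts (union F))) => [/bigcupP[H HF dH]|dF].
    rewrite (bigD1 H) //= {1}/xr dH big1 ?addr0 // => K /andP[KF KH].
    rewrite /xr; case: ifP => // dK; have /pred0P/(_ d) := F_disj KF HF KH.
    by rewrite /= dK dH.
  rewrite x0 // big1 // => H HF; rewrite /xr; case: ifP => // dH.
  by case/bigcupP: dF; exists H.
have bdxr H v : v \notin sverts H -> bd (xr H) v = 0.
  move=> vH; apply: big1 => d /eqP dv; rewrite /xr; case: ifP => // dH.
  by rewrite -dv sdarts_src in vH.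
have lam_sg H v : H \in F -> v \in sverts H -> lam (sg (H, v)) = lam (sg (hv v, v)).
  move=> HF vH; have [hF vh] := hvP v H HF vH.
  have [s1 b1] := sgP (H, v) HF vH; have [s2 b2] := sgP (hv v, v) hF vh.
  apply/eqP; rewrite -subr_eq0 -lamB; apply/eqP; apply: (Hc H (hv v)) => //.
    apply: chainB; [apply: chain_sub s1 | apply: chain_sub s2].
      exact: subsetUl.
    by rewrite -setUA [sdarts H :|: _]setUC setUA subsetUl.
  by move=> w; rewrite bdB b1 b2 subrr.
have lam_xr H : H \in F -> lam (xr H) = \sum_v bd (xr H) v * lam (sg (hv v, v)).
  move=> HF; rewrite (bigID (mem (sverts H))) /= [X in _ + X]big1 => [|v vH]; last first.
    by rewrite bdxr ?mul0r.
  rewrite addr0; apply/eqP; rewrite -subr_eq0.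
  under eq_bigr => v vH do rewrite -(lam_sg H v HF vH).
  rewrite -(lam_sum _ _ (bd (xr H)) (fun v => sg (H, v))) -lamB; apply/eqP.
  apply: (Hc H H) => //.
    apply: chainB; first by apply: chain_sub (xrP H); apply: subsetUr.
    apply: chain_sum => v vH; have [s1 _] := sgP (H, v) HF vH.
    by apply: chain_sub s1; apply: subsetUl.
  move=> w; rewrite bdB bd_sum.
  rewrite (eq_bigr (fun v => bd (xr H) v * (w == v)%:R - bd (xr H) v * (w == a0)%:R));
    last by move=> v vH; have [_ ->] := sgP (H, v) HF vH; rewrite mulrBr.
  rewrite sumrB -mulr_suml.
  have sumH f : (forall v, v \notin sverts H -> f v = 0 :> rat) ->
      \sum_(v in sverts H) f v = \sum_v f v.
    move=> f0; rewrite [RHS](bigID (mem (sverts H))) /= [X in _ = _ + X]big1 ?addr0 //.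
  rewrite sumH => [|v /bdxr ->]; last by rewrite mul0r.
  rewrite sumH; last exact: bdxr.
  (* The contributions at [a0] cancel because the boundary of [xr H] has total 0. *)
  rewrite (sum_bd (xrP H)) mul0r subr0 (bigD1 w) //= eqxx mulr1 big1 ?addr0 ?subrr //.
  by move=> v /negbTE; rewrite eq_sym => ->; rewrite mulr0.
have -> : \sum_d c d * x d = lam (fun d => \sum_(H in F) 1 * xr H d).
  by apply: eq_bigr => d _; rewrite -xE.
rewrite lam_sum.
under eq_bigr => H HF do rewrite mul1r (lam_xr H HF).
rewrite exchange_big /= big1 // => v _; rewrite -mulr_suml.
have -> : \sum_(H in F) bd (xr H) v = bd x v.
  rewrite -[RHS](_ : bd (fun d => \sum_(H in F) 1 * xr H d) v = _); last first.
    by apply: eq_bigr => d _; rewrite xE.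
  by rewrite bd_sum; apply: eq_bigr => H _; rewrite mul1r.
by rewrite xbd mul0r.
Qed.

Lemma hasgram_subfamily r : hasgram (sdarts (union F)) r ->
  exists F' : {set subgraph G}, [/\ F' \subset F, A \in F', (#|F'| <= r.*2.+1)%N &
    hasgram (sdarts (union F')) r].
Proof.
case=> p pF up.
pose Q q := exists HH : subgraph G * subgraph G, [/\ HH.1 \in F, HH.2 \in F &
  pot (sdarts A :|: sdarts HH.1 :|: sdarts HH.2) q].
have [u uF m w q|q qQ uq] := gram_exchange_all (Q := Q) (@bform_skew G) pF up.
  (* The functional depends linearly on the jump of [s], as [cycles_generated] requires; if it
     vanished on all cycles in A u H u H', it would vanish at [u]. *)
  have bE s : \sum_k w k * bform (q k) s =
      \sum_d (\sum_k w k * (q k d + q k (rot d))) * delta s d.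
    under [RHS]eq_bigr do rewrite mulr_suml.
    rewrite exchange_big; apply: eq_bigr => k _; rewrite bform_delta mulr_sumr.
    by apply: eq_bigr => d _; rewrite mulrA.
  move=> nz; apply: contrapT => noQ; case/eqP: nz; rewrite bE.
  apply: cycles_generated => [H H' HF H'F y yC ybd||v].
  - have [s sE] := exists_delta ybd.
    under eq_bigr => d _ do rewrite -sE.
    rewrite -bE; apply/eqP; apply: contrapT => /negP nz; case: noQ; exists s => //.
    exists (H, H'); split=> //=; split=> d; rewrite !sE; [exact: yC.1 | exact: yC.2].
  - exact: uF.
  - exact: sum_delta.
have /choice[h hP] := qQ.
(* The anchor and two members for each of the [r] cycles: at most 2r + 1. *)
pose F' := A |: ([set (h i).1 | i : 'I_r] :|: [set (h i).2 | i : 'I_r]).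
exists F'; split.
- rewrite subUset sub1set AF subUset /=; apply/andP; split; apply/subsetP => H.
    by case/imsetP=> i _ ->; case: (hP i).
  by case/imsetP=> i _ ->; case: (hP i).
- exact: setU11.
- rewrite /F' cardsU1; apply: (@leq_trans (1 + (r + r))%N); last by rewrite addnn.
  apply: leq_add; first by case: (_ \notin _).
  apply: leq_trans (leq_card_setU _ _) (leq_add _ _);
    by rewrite -[X in (_ <= X)%N](card_ord r) leq_imset_card.
exists q => // i; have [_ _] := hP i; apply: pot_sub.
have memU H : H \in F' -> sdarts H \subset sdarts (union F').
  by move=> HF'; apply/subsetP => d dH; apply/bigcupP; exists H.
rewrite !subUset !memU //; rewrite !inE ?eqxx //.
  by apply/orP; right; apply/orP; right; apply/imsetP; exists i.
by apply/orP; right; apply/orP; left; apply/imsetP; exists i.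
Qed.

End Cluster.

Local Close Scope ring_scope.

Theorem mainTheorem3 (G : egraph) (F : {set subgraph G}) (g : nat) :
  cluster F -> g < gen (induced (union F)) ->
  exists Fg : {set subgraph G},
    [/\ Fg \subset F, #|Fg| <= 4 * g + 5 & g < gen (induced (union Fg))].
Proof.
case=> F_conn F_disj [A AF anchor] gF.
have conn := connected_union F_conn AF anchor.
have /hasgram_induced : hasgram (G := induced (union F)) setT g.+1.*2.
  exact: (iffLR (gen_gtP g (conn F (subxx F) AF)) gF).
case/(hasgram_subfamily F_conn F_disj AF anchor) => F' [sF' AF' cardF' HF'].
(* With r = 2(g + 1), the bound 2r + 1 is 4g + 5. *)
exists F'; split=> //; first by apply: leq_trans cardF' _; lia.
apply: (iffRL (gen_gtP g (conn F' sF' AF'))); exact/hasgram_induced.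
Qed.
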